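(* Consider the following problem ( * ): given a collection $Q=\{(a_1,b_1),\ldots,(a_n,b_n)\}$ of pairs of points in the plane, with $P=\bigcup_{1\le i\le n}\{a_i,b_i\}$, find a halfplane that contains at most one point from each pair and, among such halfplanes, contains the maximum number of points of $P$. Suppose there exists an algorithm $\mathcal{A}$ which finds an optimal solution to problem ( * ) in time $T(n)$. Then the Maximum Coloring Problem (MaxCol) on $n$ pairs of points can be solved in $T(n)+O(n)$ time.
   Context: Given a collection $Q=\{(a_1,b_1),\ldots,(a_n,b_n)\}$ of pairs of points in the plane, let $P=\bigcup_{i=1}^n\{a_i,b_i\}$; all points are assumed to be in general position. A coloring is a function from $P$ to $\{\text{red},\text{blue}\}$. A coloring is valid if for each pair in $Q$ exactly one point of the pair is colored blue and the other is colored red. For a valid coloring $C$ and a halfplane $h$, let $h_r(C)$ and $h_b(C)$ be the sets of red points and blue points, respectively, lying in $h$. Let $\mathcal{H}(C)$ be the set of all halfplanes $h$ with $|h_b(C)|=0$ and define $\eta(C)=\max_{h\in\mathcal{H}(C)}|h_r(C)|$. The Maximum Coloring Problem (MaxCol) is to find a valid coloring $C$ that maximizes $\eta(C)$. *)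

(* Defs.v *)
From mathcomp Require Import all_boot all_order all_algebra.
From mathcomp Require Import boolp classical_sets reals.
From mathcomp Require Import topology normedtype landau.

Set Implicit Arguments.
Unset Strict Implicit.
Unset Printing Implicit Defensive.

Import Order.TTheory GRing.Theory Num.Theory.
Import numFieldNormedType.Exports.
Local Open Scope ring_scope.

Definition point (R : realType) : Type := (R * R)%type.

Definition instance (R : realType) (n : nat) : Type :=
  'I_n -> point R * point R.

(* The 2n points of P are addressed by labels: (i, false) is a_i and (i, true)
   is b_i. In general position the labelling is injective, so counting labels
   is counting points of P, and a function on labels is a function on P. *)
Notation label n := ('I_n * bool)%type.

Definition pt (R : realType) n (Q : instance R n) (l : label n) : point R :=
  if l.2 then (Q l.1).2 else (Q l.1).1.

Definition collinear (R : realType) (p q r : point R) : Prop :=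
  (q.1 - p.1) * (r.2 - p.2) = (q.2 - p.2) * (r.1 - p.1).

Definition general_position (R : realType) n (Q : instance R n) : Prop :=
  injective (pt Q) /\
  forall l1 l2 l3 : label n, l1 != l2 -> l1 != l3 -> l2 != l3 ->
    ~ collinear (pt Q l1) (pt Q l2) (pt Q l3).

(* The closed halfplane { (x, y) | hx * x + hy * y <= hc }. *)
Record halfplane (R : realType) := Halfplane {
  hx : R; hy : R; hc : R;
  halfplane_normal : (hx != 0) || (hy != 0) }.

Definition in_halfplane (R : realType) (h : halfplane R) (p : point R) : bool :=
  hx h * p.1 + hy h * p.2 <= hc h.

Definition points_in (R : realType) n (Q : instance R n) (h : halfplane R) :
    {set label n} :=
  [set l | in_halfplane h (pt Q l)].

Definition one_per_pair (R : realType) n (Q : instance R n) (h : halfplane R)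
    : Prop :=
  forall i : 'I_n, ~~ ((i, false) \in points_in Q h) ||
                   ~~ ((i, true) \in points_in Q h).

Definition optimal_halfplane (R : realType) n (Q : instance R n)
    (h : halfplane R) : Prop :=
  one_per_pair Q h /\
  forall h' : halfplane R, one_per_pair Q h' ->
    (#|points_in Q h'| <= #|points_in Q h|)%N.

Definition color : Type := bool.
Definition red : bool := true.
Definition blue : bool := false.

Definition coloring (n : nat) : Type := label n -> color.

Definition valid n (C : coloring n) : Prop :=
  forall i : 'I_n,
    (C (i, false) = red /\ C (i, true) = blue) \/
    (C (i, false) = blue /\ C (i, true) = red).

Definition red_in (R : realType) n (Q : instance R n) (C : coloring n)
    (h : halfplane R) : {set label n} :=
  [set l in points_in Q h | C l == red].

Definition blue_in (R : realType) n (Q : instance R n) (C : coloring n)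
    (h : halfplane R) : {set label n} :=
  [set l in points_in Q h | C l == blue].

Definition blue_free (R : realType) n (Q : instance R n) (C : coloring n) :
    set (halfplane R) :=
  [set h | #|blue_in Q C h| = 0%N]%classic.

(* The maximum of the values |h_r(C)|, which are all at most |P|, over the
   (infinite, nonempty) set of blue-free halfplanes. *)
Definition eta (R : realType) n (Q : instance R n) (C : coloring n) : nat :=
  \max_(k < #|{: label n}|.+1 |
        `[< exists2 h, blue_free Q C h & #|red_in Q C h| = k >]) k.

Definition maxcol_optimal (R : realType) n (Q : instance R n) (C : coloring n)
    : Prop :=
  valid C /\
  forall C' : coloring n, valid C' -> (eta Q C' <= eta Q C)%N.

(* Programs are structured programs over finitely many named unbounded arrays,
   of naturals (used for control and indirect addressing) and of reals. Scalar
   variables are arrays of which only the cell 0 is used. Reals can be added,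
   subtracted, multiplied, divided and compared exactly; there is no conversion
   from reals to naturals, and no real constant other than those that can be
   computed from naturals, so that a program is a finite text that depends
   neither on n nor on R. *)

Inductive nexpr : Type :=
| NConst of nat
| NLoad of nat & nexpr           (* array name, index *)
| NAdd of nexpr & nexpr
| NSub of nexpr & nexpr          (* truncated *)
| NMul of nexpr & nexpr
| NDiv of nexpr & nexpr.         (* floor; division by 0 returns 0 *)

Inductive rexpr : Type :=
| RNat of nexpr
| RLoad of nat & nexpr
| RAdd of rexpr & rexpr
| RSub of rexpr & rexpr
| RMul of rexpr & rexpr
| RDiv of rexpr & rexpr.         (* division by 0 returns 0 *)

Inductive bexpr : Type :=
| BNle of nexpr & nexpr
| BRle of rexpr & rexpr
| BNot of bexpr
| BAnd of bexpr & bexpr.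

Inductive program : Type :=
| Skip
| NStore of nat & nexpr & nexpr  (* array name, index, value *)
| RStore of nat & nexpr & rexpr
| Seq of program & program
| If of bexpr & program & program
| While of bexpr & program.

Record state (R : realType) := State {
  nmem : nat -> nat -> nat;      (* array name, index *)
  rmem : nat -> nat -> R }.

Fixpoint neval (R : realType) (s : state R) (e : nexpr) : nat :=
  match e with
  | NConst k => k
  | NLoad a i => nmem s a (neval s i)
  | NAdd e1 e2 => neval s e1 + neval s e2
  | NSub e1 e2 => neval s e1 - neval s e2
  | NMul e1 e2 => neval s e1 * neval s e2
  | NDiv e1 e2 => neval s e1 %/ neval s e2
  end%N.

Fixpoint reval (R : realType) (s : state R) (e : rexpr) : R :=
  match e with
  | RNat e1 => (neval s e1)%:R
  | RLoad a i => rmem s a (neval s i)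
  | RAdd e1 e2 => reval s e1 + reval s e2
  | RSub e1 e2 => reval s e1 - reval s e2
  | RMul e1 e2 => reval s e1 * reval s e2
  | RDiv e1 e2 => reval s e1 / reval s e2
  end.

Fixpoint beval (R : realType) (s : state R) (b : bexpr) : bool :=
  match b with
  | BNle e1 e2 => (neval s e1 <= neval s e2)%N
  | BRle e1 e2 => reval s e1 <= reval s e2
  | BNot b1 => ~~ beval s b1
  | BAnd b1 b2 => beval s b1 && beval s b2
  end.

Fixpoint ncost (e : nexpr) : nat :=
  match e with
  | NConst _ => 1
  | NLoad _ i => (ncost i).+1
  | NAdd e1 e2 | NSub e1 e2 | NMul e1 e2 | NDiv e1 e2 =>
      (ncost e1 + ncost e2).+1
  end.

Fixpoint rcost (e : rexpr) : nat :=
  match e with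
  | RNat e1 => (ncost e1).+1
  | RLoad _ i => (ncost i).+1
  | RAdd e1 e2 | RSub e1 e2 | RMul e1 e2 | RDiv e1 e2 =>
      (rcost e1 + rcost e2).+1
  end.

Fixpoint bcost (b : bexpr) : nat :=
  match b with
  | BNle e1 e2 => (ncost e1 + ncost e2).+1
  | BRle e1 e2 => (rcost e1 + rcost e2).+1
  | BNot b1 => (bcost b1).+1
  | BAnd b1 b2 => (bcost b1 + bcost b2).+1
  end.

Definition upd (V : Type) (m : nat -> nat -> V) (a i : nat) (v : V) :
    nat -> nat -> V :=
  fun a' i' => if (a' == a) && (i' == i) then v else m a' i'.

(* [exec c s t s']: started in s, c halts in state s' after t unit steps. *)
Inductive exec (R : realType) : program -> state R -> nat -> state R -> Prop :=
| ExecSkip s : exec Skip s 1 s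
| ExecNStore a i e s :
    exec (NStore a i e) s (ncost i + ncost e).+1
      (State (upd (nmem s) a (neval s i) (neval s e)) (rmem s))
| ExecRStore a i e s :
    exec (RStore a i e) s (ncost i + rcost e).+1
      (State (nmem s) (upd (rmem s) a (neval s i) (reval s e)))
| ExecSeq c1 c2 s1 s2 s3 t1 t2 :
    exec c1 s1 t1 s2 -> exec c2 s2 t2 s3 -> exec (Seq c1 c2) s1 (t1 + t2) s3
| ExecIf b c1 c2 s s' t :
    exec (if beval s b then c1 else c2) s t s' ->
    exec (If b c1 c2) s (bcost b + t).+1 s'
| ExecWhileFalse b c s :
    ~~ beval s b -> exec (While b c) s (bcost b).+1 s
| ExecWhileTrue b c s1 s2 s3 t1 t2 :
    beval s1 b -> exec c s1 t1 s2 -> exec (While b c) s2 t2 s3 ->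
    exec (While b c) s1 (bcost b + t1 + t2).+1 s3.

(* Execution is deterministic, so "some run from s" means "the run from s". *)
Lemma exec_det (R : realType) c (s s1 s2 : state R) t1 t2 :
  exec c s t1 s1 -> exec c s t2 s2 -> t1 = t2 /\ s1 = s2.
Proof.
move=> H1; elim: H1 t2 s2 => {c s t1 s1}; intros;
  match goal with H : exec _ _ _ _ |- _ => inversion H; subst end;
  repeat match goal with
  | IH : forall _ _, exec ?c ?s _ _ -> _, H : exec ?c ?s _ _ |- _ =>
      case: (IH _ _ H) => ? ?; subst; clear H
  end; try by [].
all: by match goal with
  | H : is_true (~~ ?b), H' : is_true ?b |- _ => case/negP: H
  end.
Qed.

(* Input: n in cell 0 of the array 0 of naturals; the abscissae and ordinates
   of a_i, then of b_i, in cell i of the arrays 0, 1, 2, 3 of reals. All other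
   cells are 0. *)
Definition input (R : realType) n (Q : instance R n) : state R :=
  State
    (fun a i => if (a == 0%N) && (i == 0%N) then n else 0%N)
    (fun a i => if insub i is Some j
                then [:: (Q j).1.1; (Q j).1.2; (Q j).2.1; (Q j).2.2]`_a
                else 0).

(* Output: the coefficients of the halfplane, in cells 0, 1, 2 of the array 0
   of reals. *)
Definition outputs_halfplane (R : realType) (s : state R) (h : halfplane R)
    : Prop :=
  [/\ rmem s 0 0 = hx h, rmem s 0 1 = hy h & rmem s 0 2 = hc h].

(* Output: the colors of a_i and b_i in cell i of the arrays 0 and 1 of
   naturals, 0 standing for blue and anything else for red. *)
Definition output_coloring (R : realType) n (s : state R) : coloring n :=
  fun l => if nmem s l.2 l.1 == 0%N then blue else red.

Definition solves_halfplane (R : realType) (c : program) (T : nat -> R)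
    : Prop :=
  forall (n : nat) (Q : instance R n), general_position Q ->
  exists (t : nat) (s : state R),
    [/\ exec c (input Q) t s, t%:R <= T n &
        exists2 h, outputs_halfplane s h & optimal_halfplane Q h].

Definition solves_maxcol (R : realType) (c : program) (T : nat -> R) : Prop :=
  forall (n : nat) (Q : instance R n), general_position Q ->
  exists (t : nat) (s : state R),
    [/\ exec c (input Q) t s, t%:R <= T n &
        maxcol_optimal Q (output_coloring s)].

(* Main.v *)
(** A coloring in which a halfplane [h] is blue-free and holds [k] red points
    makes [h] contain exactly [k] points of P, at most one from each pair.
    Conversely, if [h] contains at most one point from each pair, the coloring
    that makes [a_i] red when it lies in [h], and [b_i] red otherwise, leaves
    [h] blue-free. So this coloring is optimal when [h] is. Since the given
    algorithm may overwrite its input, the points are first copied to arrays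
    whose names it does not mention. *)
Require Import Defs.
From mathcomp Require Import all_boot all_order all_algebra.
From mathcomp Require Import boolp classical_sets reals.
From mathcomp Require Import topology normedtype landau.
From mathcomp Require Import zify.

Set Implicit Arguments.
Unset Strict Implicit.
Unset Printing Implicit Defensive.

Import Order.TTheory GRing.Theory Num.Theory.
Import numFieldNormedType.Exports.
Local Open Scope ring_scope.
Local Open Scope classical_set_scope.

(** * Colorings and blue-free halfplanes *)

Definition halfplane_coloring (R : realType) n (Q : instance R n)
    (h : halfplane R) : coloring n :=
  fun l => if l.2 then ~~ in_halfplane h (Q l.1).1 else in_halfplane h (Q l.1).1.

Lemma halfplane_coloring_valid (R : realType) n (Q : instance R n) h :
  valid (halfplane_coloring Q h).
Proof.
rewrite /halfplane_coloring => i /=.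
by case: (in_halfplane _ _); [left | right].
Qed.

(** The point [a_i] is blue only outside [h]. The point [b_i] is blue only when [a_i] lies in [h],
    and then the hypothesis keeps [b_i] out of [h]. *)
Lemma halfplane_coloring_blue_free (R : realType) n (Q : instance R n) h :
  one_per_pair Q h -> blue_free Q (halfplane_coloring Q h) h.
Proof.
move=> h1; apply/eqP; rewrite cards_eq0; apply/eqP/setP => -[i x].
have := h1 i; rewrite !inE /halfplane_coloring /pt /blue /=.
by case: x => /=; do 2 case: (in_halfplane _ _).
Qed.

Lemma blue_free_red_in (R : realType) n (Q : instance R n) C h :
  blue_free Q C h -> red_in Q C h = points_in Q h.
Proof.
move=> /eqP; rewrite cards_eq0 => /eqP/setP b0; apply/setP => l.
have := b0 l; rewrite !inE /blue /red.
by case: (in_halfplane _ _); case: (C l).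
Qed.

Lemma blue_free_one_per_pair (R : realType) n (Q : instance R n) C h :
  valid C -> blue_free Q C h -> one_per_pair Q h.
Proof.
move=> vC /blue_free_red_in rE i; rewrite -rE !inE /=.
by case: (vC i) => -[-> ->]; rewrite !andbF ?orbT.
Qed.

Lemma eta_ge (R : realType) n (Q : instance R n) C h :
  blue_free Q C h -> (#|points_in Q h| <= eta Q C)%N.
Proof.
move=> bh; have lt_h : (#|points_in Q h| < #|{: label n}|.+1)%N.
  by rewrite ltnS max_card.
rewrite /eta (bigD1 (Ordinal lt_h)) /= ?leq_maxl //.
by apply/asboolP; exists h => //; rewrite blue_free_red_in.
Qed.

Lemma eta_le (R : realType) n (Q : instance R n) C h :
  valid C -> optimal_halfplane Q h -> (eta Q C <= #|points_in Q h|)%N.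
Proof.
move=> vC [_ hmax]; apply/bigmax_leqP => k /asboolP[h' bh' <-].
by rewrite blue_free_red_in // hmax //; apply: blue_free_one_per_pair bh'.
Qed.

Lemma halfplane_coloring_optimal (R : realType) n (Q : instance R n) h :
  optimal_halfplane Q h -> maxcol_optimal Q (halfplane_coloring Q h).
Proof.
move=> oh; split=> [|C' vC']; first exact: halfplane_coloring_valid.
apply: leq_trans (eta_le vC' oh) (eta_ge _).
by apply: halfplane_coloring_blue_free; case: oh.
Qed.

(** * Independence of a run from the arrays that its program does not mention *)

(* Upper bounds on the array names that occur in a text: all are smaller. *)
Fixpoint nnames (e : nexpr) : nat :=
  match e with
  | NConst _ => 0
  | NLoad a i => maxn a.+1 (nnames i)
  | NAdd e1 e2 | NSub e1 e2 | NMul e1 e2 | NDiv e1 e2 =>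
      maxn (nnames e1) (nnames e2)
  end.

Fixpoint rnames (e : rexpr) : nat :=
  match e with
  | RNat e1 => nnames e1
  | RLoad a i => maxn a.+1 (nnames i)
  | RAdd e1 e2 | RSub e1 e2 | RMul e1 e2 | RDiv e1 e2 =>
      maxn (rnames e1) (rnames e2)
  end.

Fixpoint bnames (b : bexpr) : nat :=
  match b with
  | BNle e1 e2 => maxn (nnames e1) (nnames e2)
  | BRle e1 e2 => maxn (rnames e1) (rnames e2)
  | BNot b1 => bnames b1
  | BAnd b1 b2 => maxn (bnames b1) (bnames b2)
  end.

Fixpoint pnames (c : program) : nat :=
  match c with
  | Skip => 0
  | NStore a i e => maxn a.+1 (maxn (nnames i) (nnames e))
  | RStore a i e => maxn a.+1 (maxn (nnames i) (rnames e))
  | Seq c1 c2 => maxn (pnames c1) (pnames c2)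
  | If b c1 c2 => maxn (bnames b) (maxn (pnames c1) (pnames c2))
  | While b c1 => maxn (bnames b) (pnames c1)
  end.

(** In use, [D] is either the set of names below a bound [K], which covers all that a program can
    touch, or its complement. *)
Definition agree_on (R : realType) (D : pred nat) (s s' : state R) : Prop :=
  forall a, D a -> nmem s a =1 nmem s' a /\ rmem s a =1 rmem s' a.

Lemma agree_on_trans (R : realType) D (s1 s2 s3 : state R) :
  agree_on D s1 s2 -> agree_on D s2 s3 -> agree_on D s1 s3.
Proof.
move=> h12 h23 a Da; have [n12 r12] := h12 a Da; have [n23 r23] := h23 a Da.
by split=> i; [rewrite n12 | rewrite r12].
Qed.

Section Frame.
Variables (R : realType) (K : nat).
Implicit Types s : state R.
Local Notation below := (fun a : nat => (a < K)%N).
Local Notation above := (fun a : nat => (K <= a)%N).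

Lemma neval_agree s s' e :
  agree_on below s s' -> (nnames e <= K)%N -> neval s e = neval s' e.
Proof.
move=> ss'; elim: e => //= [a i IH|? IH1 ? IH2|? IH1 ? IH2|? IH1 ? IH2
  |? IH1 ? IH2]; rewrite geq_max => /andP[h1 h2].
- by rewrite IH // (proj1 (ss' a h1)).
all: by rewrite IH1 // IH2.
Qed.

Lemma reval_agree s s' e :
  agree_on below s s' -> (rnames e <= K)%N -> reval s e = reval s' e.
Proof.
move=> ss'; elim: e => /= [e|a i|? IH1 ? IH2|? IH1 ? IH2|? IH1 ? IH2
  |? IH1 ? IH2].
- by move=> h; rewrite (neval_agree ss').
all: rewrite geq_max => /andP[h1 h2].
- by rewrite (neval_agree ss') // (proj2 (ss' a h1)).
all: by rewrite IH1 // IH2.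
Qed.

Lemma beval_agree s s' b :
  agree_on below s s' -> (bnames b <= K)%N -> beval s b = beval s' b.
Proof.
move=> ss'; elim: b => /= [? ?|? ?|b IH|? IH1 ? IH2].
3: by move=> h; rewrite IH.
all: rewrite geq_max => /andP[h1 h2].
- by rewrite !(neval_agree ss').
- by rewrite !(reval_agree ss').
- by rewrite IH1 // IH2.
Qed.

Lemma upd_agree (V : Type) (m m' : nat -> nat -> V) b i v a :
  m a =1 m' a -> upd m b i v a =1 upd m' b i v a.
Proof. by move=> mm' j; rewrite /upd mm'. Qed.

Lemma upd_other (V : Type) (m : nat -> nat -> V) b i v a :
  a != b -> upd m b i v a =1 m a.
Proof. by move=> /negbTE ab j; rewrite /upd ab. Qed.

(** Every expression reads names below [K] only, so both runs take the same branches at the same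
    cost, and every store hits a name below [K]. This allows the given algorithm to start from a
    state that already holds the copies. *)
Lemma exec_frame c s t s' s1 :
  exec c s t s' -> (pnames c <= K)%N -> agree_on below s s1 ->
  exists s1', [/\ exec c s1 t s1', agree_on below s' s1' &
                  agree_on above s1 s1'].
Proof.
move=> H; elim: H s1 => {c s t s'} /=.
- by move=> s s1 _ ss1; exists s1; split=> //; apply: ExecSkip.
- move=> a i e s s1; rewrite !geq_max => /and3P[ha hi he] ss1.
  eexists; split; first exact: ExecNStore.
  + move=> b hb; have [nb rb] := ss1 b hb; split=> //=.
    by rewrite -!(neval_agree ss1) //; apply: upd_agree.
  + move=> b hb; split=> //= j; rewrite upd_other //.
    by apply: contraTneq ha => <-; rewrite -leqNgt.
- move=> a i e s s1; rewrite !geq_max => /and3P[ha hi he] ss1.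
  eexists; split; first exact: ExecRStore.
  + move=> b hb; have [nb rb] := ss1 b hb; split=> //=.
    by rewrite -(neval_agree ss1) // -(reval_agree ss1) //; apply: upd_agree.
  + move=> b hb; split=> //= j; rewrite upd_other //.
    by apply: contraTneq ha => <-; rewrite -leqNgt.
- move=> c1 c2 s1 s2 s3 t1 t2 _ IH1 _ IH2 r1; rewrite geq_max => /andP[h1 h2].
  move=> /(IH1 _ h1)[r2 [e1 b1 a1]]; have [r3 [e2 b2 a2]] := IH2 _ h2 b1.
  by exists r3; split=> //; [apply: ExecSeq e1 e2 | apply: agree_on_trans a1 a2].
- move=> b c1 c2 s s' t _ IH r; rewrite !geq_max => /and3P[hb h1 h2] sr.
  have hc : (pnames (if beval s b then c1 else c2) <= K)%N by case: ifP.
  have [r' [e1 b1 a1]] := IH _ hc sr; exists r'; split=> //.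
  by apply: ExecIf; rewrite -(beval_agree sr).
- move=> b c s bF r; rewrite geq_max => /andP[hb hc] sr.
  exists r; split=> //; apply: ExecWhileFalse.
  by rewrite -(beval_agree sr).
- move=> b c s1 s2 s3 t1 t2 bT _ IH1 _ IH2 r1 hbc; have := hbc.
  rewrite geq_max => /andP[hb hc] sr.
  have [r2 [e1 b1 a1]] := IH1 _ hc sr; have [r3 [e2 b2 a2]] := IH2 _ hbc b1.
  exists r3; split=> //; last exact: agree_on_trans a1 a2.
  by apply: ExecWhileTrue e1 e2; rewrite -(beval_agree sr).
Qed.

End Frame.

(** * Exact running time of counted loops *)

Lemma exec_while_count (R : realType) b c n d (Inv : nat -> state R -> Prop) s :
  (forall i s, Inv i s -> beval s b = (i < n)%N) ->
  (forall i s, (i < n)%N -> Inv i s ->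
     exists2 s', exec c s d s' & Inv i.+1 s') ->
  Inv 0%N s ->
  exists2 s', exec (While b c) s (n * (bcost b + d).+1 + (bcost b).+1) s' &
              Inv n s'.
Proof.
move=> guard step I0.
(* The induction is on the number [m] of iterations still to come. *)
suff H m i s1 : (i + m)%N = n -> Inv i s1 ->
    exists2 s', exec (While b c) s1 (m * (bcost b + d).+1 + (bcost b).+1) s' &
                Inv n s' by exact: (H n 0%N s).
elim: m i s1 => [|m IH] i s1.
  rewrite addn0 => -> In; exists s1 => //; apply: ExecWhileFalse.
  by rewrite (guard _ _ In) ltnn.
move=> imn Ii; have lt_in : (i < n)%N by rewrite -imn -addSnnS leq_addr.
have [s2 e2 I2] := step _ _ lt_in Ii.
have [s3 e3 I3] := IH i.+1 s2 (etrans (addSnnS _ _) imn) I2.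
exists s3 => //; rewrite mulSn -addnA addSn.
by apply: ExecWhileTrue e2 e3; rewrite (guard _ _ Ii).
Qed.

(* A loop on the counter, cell 0 of the array of naturals [K.+1], up to the
   content of cell 0 of the array of naturals [K]. *)
Definition counter (K : nat) : nexpr := NLoad K.+1 (NConst 0).

Definition for_all_pairs (K : nat) (c : program) : program :=
  Seq (NStore K.+1 (NConst 0) (NConst 0))
      (While (BNot (BNle (NLoad K (NConst 0)) (counter K)))
             (Seq c (NStore K.+1 (NConst 0) (NAdd (counter K) (NConst 1))))).

(** The effect of the counter store that opens the loop and ends each iteration, so that invariants
    speak of the state at the guard. *)
Definition set_counter (R : realType) (K i : nat) (s : state R) : state R :=
  State (upd (nmem s) K.+1 0 i) (rmem s).

Lemma exec_for_all_pairs (R : realType) K c n d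
    (Inv : nat -> state R -> Prop) s :
  (forall i s, Inv i s -> nmem s K 0%N = n /\ nmem s K.+1 0%N = i) ->
  (forall i s, (i < n)%N -> Inv i s ->
     exists s', [/\ exec c s d s', nmem s' K.+1 0%N = i &
                    Inv i.+1 (set_counter K i.+1 s')]) ->
  Inv 0%N (set_counter K 0 s) ->
  exists2 s', exec (for_all_pairs K c) s (n * (d + 13) + 10) s' & Inv n s'.
Proof.
move=> hmem step I0.
set b := BNot (BNle (NLoad K (NConst 0)) (counter K)).
set c' := Seq c (NStore K.+1 (NConst 0) (NAdd (counter K) (NConst 1))).
have [i r Ii|i r lt_in Ii|s' es' Is'] :=
    @exec_while_count R b c' n (d + 6) Inv _ _ _ I0.
- by have [/= -> ->] := hmem _ _ Ii; rewrite -ltnNge.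
- have [r' [er' r'i Ir']] := step _ _ lt_in Ii.
  exists (set_counter K i.+1 r') => //.
  have -> : i.+1 = (nmem r' K.+1 0 + 1)%N by rewrite r'i addn1.
  exact: (ExecSeq er' (ExecNStore _ _ _ _)).
- exists s' => //.
  (* The initial store costs 3. An iteration costs 6 for the guard, [d] for [c], 6 for the increment
     and 1 for the loop itself. The failing last test costs 7. *)
  have -> : (n * (d + 13) + 10 = 3 + (n * (6 + (d + 6)).+1 + 7))%N.
    by lia.
  exact: ExecSeq (ExecNStore K.+1 (NConst 0) (NConst 0) s) es'.
Qed.

(** * The program of the reduction *)

Definition save_coordinate (K a : nat) : program :=
  RStore (K + a) (counter K) (RLoad a (counter K)).

Definition save_pair (K : nat) : program :=
  Seq (Seq (save_coordinate K 0) (save_coordinate K 1))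
      (Seq (save_coordinate K 2) (save_coordinate K 3)).

Definition set_colors (K k l : nat) : program :=
  Seq (NStore 0 (counter K) (NConst k)) (NStore 1 (counter K) (NConst l)).

Definition color_pair (K : nat) : program :=
  let coef k := RLoad 0 (NConst k) in
  If (BRle (RAdd (RMul (coef 0%N) (RLoad (K + 0) (counter K)))
                 (RMul (coef 1%N) (RLoad (K + 1) (counter K))))
           (coef 2%N))
     (set_colors K 1 0) (set_colors K 0 1).

(* Uses the arrays of naturals [K], [K.+1] and the arrays of reals [K], ...,
   [K + 3] besides those of [A]. *)
Definition reduction (A : program) (K : nat) : program :=
  Seq (Seq (NStore K (NConst 0) (NLoad 0 (NConst 0)))
           (for_all_pairs K (save_pair K)))
      (Seq A (for_all_pairs K (color_pair K))).

(** * Correctness and cost of the reduction *)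

Section Correctness.
Variables (R : realType) (K n : nat) (Q : instance R n).
(** Keeps the copies and the control variables apart from the input arrays 0 to 3 and the color
    arrays 0 and 1. *)
Hypothesis K_ge4 : (4 <= K)%N.

Definition saved (m : nat) (s : state R) : Prop :=
  nmem s K 0 = n /\
  forall a j, (a < 4)%N -> (j < m)%N -> rmem s (K + a) j = rmem (input Q) a j.

Definition saving (i : nat) (s : state R) : Prop :=
  [/\ nmem s K.+1 0 = i, agree_on (fun a => (a < K)%N) (input Q) s & saved i s].

Lemma exec_save_pair i s : (i < n)%N -> saving i s ->
  exists s', [/\ exec (save_pair K) s 24 s', nmem s' K.+1 0 = i &
                 saving i.+1 (set_counter K i.+1 s')].
Proof.
move=> lt_in [si ss [sn sp]]; eexists; split.
- exact: (ExecSeq (ExecSeq (ExecRStore _ _ _ _) (ExecRStore _ _ _ _))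
                  (ExecSeq (ExecRStore _ _ _ _) (ExecRStore _ _ _ _))).
- by [].
split.
- by rewrite /= /upd !eqxx.
- move=> a ltaK; have [na ra] := ss a ltaK; split=> j.
    by rewrite na /= upd_other // ltn_eqF // ltnS ltnW.
  by rewrite ra /= !upd_other // ltn_eqF // ltn_addr.
split=> [|a j a4 ]; first by rewrite /= /upd ltn_eqF.
(* Writing a copy never disturbs an input array that a later store of the same pair reads. *)
have F b k : (b < 4)%N -> (b == K + k)%N = false.
  by move=> b4; rewrite ltn_eqF // ltn_addr // (leq_trans b4).
rewrite ltnS leq_eqVlt /= /upd /= si !eqn_add2l !F //= => /predU1P[->|ltji].
  have ra b : (b < 4)%N -> rmem (input Q) b i = rmem s b i.
    by move=> b4; have [] := ss b (leq_trans b4 K_ge4).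
  by rewrite eqxx !andbT; case: a a4 => [|[|[|[|//]]]] _ /=; rewrite -ra.
by rewrite [j == i]ltn_eqF // !andbF sp.
Qed.

(** Two coercions from booleans to naturals are at work: [x] names the array of [a_i] or of [b_i],
    and red is stored as 1, blue as 0. Colors go to arrays of naturals, so the coefficients of [h]
    in the real array 0 survive. *)
Definition coloring_pairs (h : halfplane R) (i : nat) (s : state R) : Prop :=
  [/\ nmem s K.+1 0 = i, saved n s, outputs_halfplane s h &
      forall (x : bool) (j : 'I_n), (j < i)%N ->
        nmem s x j = halfplane_coloring Q h (j, x)].

Lemma exec_color_pair h i s : (i < n)%N -> coloring_pairs h i s ->
  exists s', [/\ exec (color_pair K) s 25 s', nmem s' K.+1 0 = i &
                 coloring_pairs h i.+1 (set_counter K i.+1 s')].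
Proof.
move=> lt_in [si [sn sp] [s0 s1 s2] sc].
pose k : bool := in_halfplane h (Q (Ordinal lt_in)).1.
(* Storing [k] and its negation as numbers describes both branches of the conditional at once. *)
pose s' := State (upd (upd (nmem s) 0 i k) 1 i (~~ k)) (rmem s).
have K0 a : (a < 4)%N -> (K == a) = false.
  by move=> a4; rewrite gtn_eqF // (leq_trans a4).
have KS a : (a < 4)%N -> (a == K.+1) = false.
  by move=> a4; rewrite ltn_eqF // (leq_trans a4) // leqW.
have x4 (x : bool) : (x < 4)%N by case: x.
exists s'; split.
- have inp a : (a < 4)%N -> rmem s (K + a) i =
      [:: (Q (Ordinal lt_in)).1.1; (Q (Ordinal lt_in)).1.2;
          (Q (Ordinal lt_in)).2.1; (Q (Ordinal lt_in)).2.2]`_a.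
    by move=> a4; rewrite sp //= (insubT (fun i => (i < n)%N) lt_in).
  (* The comparison costs 16, either branch 8, and the conditional 1. *)
  rewrite -[25%N]/((16 + 8).+1)%N; apply: ExecIf.
  rewrite /= si s0 s1 s2 !inp //= -/(in_halfplane h _) -/k /s' -si.
  by case: (k); exact: (ExecSeq (ExecNStore _ _ _ _) (ExecNStore _ _ _ _)).
- by rewrite /= /upd ![K.+1 == _]eq_sym !KS.
split.
- by rewrite /= /upd !eqxx.
- split=> [|//]; by rewrite /= /upd ltn_eqF // !K0.
- by [].
move=> x j; rewrite ltnS leq_eqVlt => /predU1P[ji|ltji].
  have -> : j = Ordinal lt_in by apply: val_inj.
  by rewrite /= /upd KS //=; case: (x); rewrite /= eqxx.
by rewrite /= /upd KS // [j == i :> nat]ltn_eqF // !andbF /= sc.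
Qed.

Lemma exec_reduction A t s h :
  (pnames A <= K)%N -> exec A (input Q) t s -> outputs_halfplane s h ->
  exists2 s', exec (reduction A K) (input Q) (t + (n * 75 + 24)) s' &
              output_coloring s' = halfplane_coloring Q h.
Proof.
move=> AK eA [h0 h1 h2].
pose s0 := State (upd (nmem (input Q)) K 0 n) (rmem (input Q)).
have e0 : exec (NStore K (NConst 0) (NLoad 0 (NConst 0))) (input Q) 4 s0.
  exact: ExecNStore.
have [i r [-> _ []]//|i r||s1 e1 [_ ag1 sv1]] :=
    @exec_for_all_pairs R K (save_pair K) n 24 saving s0.
- exact: exec_save_pair.
- split=> [|a ltaK|].
  + by rewrite /= /upd !eqxx.
  + by split=> // j; rewrite /= !upd_other // ltn_eqF // ltnS ltnW.
  + by split=> //; rewrite /= /upd !eqxx ltn_eqF.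
(* The run of [A] from the input is replayed from [s1], in the same time [t]: [ag2] carries over its
   output and [fr2] preserves the copies. *)
have [s2 [e2 ag2 fr2]] := exec_frame eA AK ag1.
have [r0 r1 r2] : [/\ rmem s2 0 0 = hx h, rmem s2 0 1 = hy h & rmem s2 0 2 = hc h].
  have [|_ E] := ag2 0%N; first exact: leq_trans K_ge4.
  by rewrite -!E.
have [i r [-> [-> _]]//|i r||s3 e3 [_ _ _ col]] :=
    @exec_for_all_pairs R K (color_pair K) n 25 (coloring_pairs h) s2.
- exact: exec_color_pair.
- have [sn sp] := sv1; split=> //.
  + by rewrite /= /upd !eqxx.
  + split=> [|a j a4 ltjn].
      by rewrite /= /upd ltn_eqF //= -(proj1 (fr2 K (leqnn K))).
    by rewrite -sp // -(proj2 (fr2 (K + a)%N (leq_addr _ _))).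
exists s3.
  (* Copying [n] costs 4; the saving loop takes 37 steps per pair, the coloring loop 38, and each
     loop 10 more. *)
  have -> : (t + (n * 75 + 24) =
             4 + (n * (24 + 13) + 10) + (t + (n * (25 + 13) + 10)))%N.
    by lia.
  exact: ExecSeq (ExecSeq e0 e1) (ExecSeq e2 e3).
apply/funext => -[i x]; rewrite /output_coloring /= col //.
by case: (halfplane_coloring _ _ _).
Qed.

End Correctness.

Lemma affine_bigO (R : realType) (p q : nat) :
  ((fun n => (n * p + q)%:R) : nat -> R^o) =O_\oo (fun n : nat => n%:R : R^o).
Proof.
(* For positive [n], [q] is at most [n * q]; the successor keeps the constant positive when [p] and
   [q] vanish. *)
apply/eqO_exP; exists (p + q).+1%:R; first by rewrite ltr0n.
near=> n; have n_gt0 : (0 < n)%N by near: n; exact: nbhs_infty_gt.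
by rewrite !ger0_norm ?ler0n // -natrM ler_nat; nia.
Unshelve. all: by end_near. Qed.

Theorem lemma11 (R : realType) (T : nat -> R)
    (hA : exists A : program, solves_halfplane A T) :
  exists (B : program) (g : nat -> R),
    (g : nat -> R^o) =O_\oo (fun n : nat => n%:R : R^o) /\
    solves_maxcol B (fun n => T n + g n).
Proof.
(* [K] depends on the text of [A] alone, so one program serves all [n] and [Q]. *)
have [A solA] := hA; pose K := maxn 4 (pnames A).
exists (reduction A K), (fun n => (n * 75 + 24)%:R); split.
  exact: affine_bigO.
move=> n Q /solA[t [s [eA tT [h outh opth]]]].
have [s' es' colE] := exec_reduction (leq_maxl 4 _) (leq_maxr _ _) eA outh.
exists (t + (n * 75 + 24))%N, s'; split=> //.
  by rewrite natrD lerD2r.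
by rewrite colE; apply: halfplane_coloring_optimal.
Qed.
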